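(* Let $k\geq 1$ be an integer and let $n\geq GR_k(K_3)$. Write $n=5^{\lfloor(k-1)/2\rfloor}m+r$, where $m$ and $r$ are nonnegative integers with $0\leq r\leq 5^{\lfloor(k-1)/2\rfloor}-1$. Then $$g_{k}(K_3,n)\leq \begin{cases} r\binom{m+1}{3}+\left(5^{(k-1)/2}-r\right)\binom{m}{3}, & \text{if $k$ is odd},\\ rM_2(K_3, m+1)+\left(5^{(k-2)/2}-r\right)M_2(K_3, m), & \text{if $k$ is even}.\end{cases}$$ Moreover, letting $s_0=1$ if $k$ is odd and $s_0=2$ if $k$ is even, $$g_{k}(K_3,n)\geq \frac{s_0n(n-1)(n-2)}{GR_k(K_3)(GR_k(K_3)-1)(GR_k(K_3)-2)}.$$
   Context: A $k$-edge-coloring of a graph is a map from its edge set to $[k]=\{1,\dots,k\}$ (not necessarily proper). A subgraph is rainbow if all its edges have distinct colors and monochromatic if all its edges have the same color. A Gallai-$k$-coloring is a $k$-edge-coloring of a complete graph containing no rainbow triangle. $GR_k(K_3)$ is the minimum integer $N$ such that every Gallai-$k$-coloring of $K_N$ contains a monochromatic triangle. $g_k(K_3,n)$ is the minimum number of monochromatic triangles (as subgraphs) taken over all Gallai-$k$-colorings of $K_n$. $M_2(K_3,m)$ is the minimum number of monochromatic triangles taken over all $2$-edge-colorings of $K_m$. By convention $\binom{a}{3}=0$ for $a<3$. *)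

(* Defs.v *)
From mathcomp Require Import all_boot all_order all_algebra.

Set Implicit Arguments.
Unset Strict Implicit.
Unset Printing Implicit Defensive.

(* Edges of the complete graph on the vertex set T. *)
Definition edge (T : finType) : Type := {e : {set T} | #|e| == 2}.

Definition coloring (k : nat) (T : finType) : finType :=
  {ffun edge T -> 'I_k}.

Definition edges_in (T : finType) (A : {set T}) : {set edge T} :=
  [set e : edge T | val e \subset A].

(* A triangle of a complete graph is determined by its 3-element vertex set. *)
Definition triangles (T : finType) : {set {set T}} :=
  [set A : {set T} | #|A| == 3].

Section Colorings.

Variables (k : nat) (T : finType).

Definition rainbow (c : coloring k T) (F : {set edge T}) : bool :=
  [forall e in F, forall f in F, (c e == c f) ==> (e == f)].

Definition monochromatic (c : coloring k T) (F : {set edge T}) : bool :=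
  [forall e in F, forall f in F, c e == c f].

Definition gallai (c : coloring k T) : bool :=
  [forall A in triangles T, ~~ rainbow c (edges_in A)].

Definition mono_triangles (c : coloring k T) : {set {set T}} :=
  [set A in triangles T | monochromatic c (edges_in A)].

End Colorings.

(* K_n is the complete graph on 'I_n.  The default value 'C(n, 3) of the minima
   below is the total number of triangles of K_n, hence an upper bound of all
   the values over which the minimum is taken; see g3P and M2P. *)

Definition g3 (k n : nat) : nat :=
  \big[minn/'C(n, 3)]_(c : coloring k 'I_n | gallai c) #|mono_triangles c|.

Definition M2 (m : nat) : nat :=
  \big[minn/'C(m, 3)]_(c : coloring 2 'I_m) #|mono_triangles c|.

Lemma bigminP (I : finType) (P : pred I) (F : I -> nat) (b : nat) :
  (forall i, P i -> F i <= b) -> (exists i, P i) ->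
  (exists2 i, P i & F i = \big[minn/b]_(i | P i) F i) /\
  (forall i, P i -> \big[minn/b]_(i | P i) F i <= F i).
Proof.
move=> Fb [i0 Pi0].
have lb i : P i -> \big[minn/b]_(i | P i) F i <= F i.
  move=> Pi; have := mem_index_enum i; elim: (index_enum I) => // j r IHr.
  rewrite inE big_cons => /predU1P[<-|/IHr]; first by rewrite Pi geq_minl.
  by case: ifP => // _; apply: leq_trans; rewrite geq_minr.
split=> //; case: (arg_minnP F Pi0) => i Pi iP.
exists i => //; apply/eqP; rewrite eqn_leq lb // andbT.
by elim/big_ind: _ => [|x y Hx Hy|j /iP //]; [exact: Fb | rewrite leq_min Hx].
Qed.

Lemma mono_triangles_le k n (c : coloring k 'I_n) :
  #|mono_triangles c| <= 'C(n, 3).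
Proof.
have <- : #|triangles 'I_n| = 'C(n, 3) by rewrite card_draws card_ord.
by apply/subset_leq_card/subsetP => A; rewrite inE => /andP[].
Qed.

Lemma card3E (T : finType) (A : {set T}) : #|A| = 3 ->
  exists x y z, [/\ x != y, x != z, y != z & A = [set x; y; z]].
Proof.
move=> A3; have /card_gt0P[x xA] : 0 < #|A| by rewrite A3.
have /eqP/cards2P[y [z [yz AE]]] : #|A :\ x| = 2.
  by have := cardsD1 x A; rewrite xA A3 => -[].
exists x, y, z; have : x \notin A :\ x by rewrite !inE eqxx.
rewrite AE !inE negb_or => /andP[xy xz]; split=> //.
by rewrite -(setD1K xA) AE setUA.
Qed.

Lemma gallai_const k (T : finType) (a : 'I_k) :
  gallai ([ffun=> a] : coloring k T).
Proof.
apply/forall_inP => A; rewrite inE => /eqP/card3E[x [y [z [xy xz yz ->]]]].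
have Exy : #|[set x; y]| == 2 by rewrite cards2 xy.
have Exz : #|[set x; z]| == 2 by rewrite cards2 xz.
pose e : edge T := Sub [set x; y] Exy; pose f : edge T := Sub [set x; z] Exz.
have eA : e \in edges_in [set x; y; z] by rewrite inE /= subsetUl.
have fA : f \in edges_in [set x; y; z].
  by rewrite inE /=; apply/subsetP => t; rewrite !inE => /orP[]->; rewrite ?orbT.
apply/negP => /forall_inP/(_ _ eA)/forall_inP/(_ _ fA).
rewrite !ffunE eqxx /= => /eqP/(congr1 val) /= /setP/(_ y).
by rewrite !inE eqxx orbT (negPf yz) eq_sym (negPf xy).
Qed.

Lemma g3P k n : 0 < k ->
  (exists2 c : coloring k 'I_n, gallai c & #|mono_triangles c| = g3 k n) /\
  (forall c : coloring k 'I_n, gallai c -> g3 k n <= #|mono_triangles c|).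
Proof.
move=> k0; apply: bigminP => [c _|]; first exact: mono_triangles_le.
by exists [ffun=> Ordinal k0]; exact: gallai_const.
Qed.

Lemma M2P m :
  (exists c : coloring 2 'I_m, #|mono_triangles c| = M2 m) /\
  (forall c : coloring 2 'I_m, M2 m <= #|mono_triangles c|).
Proof.
have [||[c _ cE] H] := @bigminP (coloring 2 'I_m) xpredT
  (fun c => #|mono_triangles c|) 'C(m, 3).
- by move=> c _; exact: mono_triangles_le.
- by exists [ffun=> ord0].
- by split; [exists c | move=> d; exact: H].
Qed.

Definition forces_mono (k N : nat) : bool :=
  [forall c : coloring k 'I_N, gallai c ==> (mono_triangles c != set0)].

Fixpoint ramsey_bound (j : nat) : nat :=
  if j is j'.+1 then (j * ramsey_bound j').+1 else 2.

Lemma ramsey_K3 (T I : finType) (f : T -> T -> I) j (C : {set I})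
    (V : {set T}) :
  #|C| <= j -> ramsey_bound j <= #|V| ->
  {in V &, forall x y, x != y -> f x y \in C} ->
  exists x y z, [/\ x != y, x != z, y != z,
                    f x y = f x z & f x y = f y z].
Proof.
elim: j C V => [|j IHj] C V Cj VR VC.
  have /card_gt1P[x [y [xV yV xy]]] : 1 < #|V| by [].
  have := VC _ _ xV yV xy.
  by move: Cj; rewrite leqn0 cards_eq0 => /eqP->; rewrite inE.
have /card_gt0P[v vV] : 0 < #|V| by exact: leq_trans VR.
have VvR : j.+1 * ramsey_bound j <= #|V :\ v|.
  by move: VR; rewrite (cardsD1 v V) vV.
pose N i := [set u in V :\ v | f v u == i].
have [/exists_inP[i iC iR]|] :=
    boolP [exists i in C, ramsey_bound j <= #|N i|]; last first.
  rewrite negb_exists_in => /forall_inP small.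
  suff : #|V :\ v| < j.+1 * ramsey_bound j by rewrite ltnNge VvR.
  have R0 : 0 < ramsey_bound j by case: (j).
  have : #|V :\ v| <= #|C| * (ramsey_bound j).-1.
    rewrite -sum1_card (partition_big (f v) (mem C)) /=; last first.
      move=> u; rewrite !inE => /andP[uv uV].
      by apply: VC; rewrite // eq_sym.
    rewrite -sum_nat_const leq_sum // => i iC.
    have := small i iC; rewrite -ltnNge -{1}(prednK R0) ltnS.
    by apply: leq_trans; rewrite -sum1_card; apply/eq_leq/eq_bigl => u; rewrite !inE.
  move=> /leq_ltn_trans; apply.
  apply: (@leq_ltn_trans (j.+1 * (ramsey_bound j).-1)).
    by rewrite leq_mul2r Cj orbT.
  by rewrite ltn_mul2l /= prednK.
have [/exists_inP[u uN /exists_inP[w wN /andP[uw /eqP fuw]]]|] :=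
    boolP [exists u in N i, exists w in N i, (u != w) && (f u w == i)].
  move: uN wN; rewrite !inE => /andP[/andP[uv _] /eqP fu] /andP[/andP[wv _] /eqP fw].
  by exists v, u, w; rewrite fu fw fuw ![v == _]eq_sym.
rewrite negb_exists_in => /forall_inP no.
apply: (IHj (C :\ i) (N i)) => //.
  by move: Cj; rewrite (cardsD1 i C) iC.
move=> u w uN wN uw; rewrite !inE.
have := no u uN; rewrite negb_exists_in => /forall_inP/(_ w wN).
rewrite uw /= => ->; move: uN wN; rewrite !inE => /andP[/andP[_ uV] _].
by move=> /andP[/andP[_ wV] _]; exact: VC.
Qed.

Lemma edges_in3 (T : finType) (x y z : T) (e : edge T) :
  e \in edges_in [set x; y; z] ->
  [\/ val e = [set x; y], val e = [set x; z] | val e = [set y; z]].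
Proof.
rewrite inE; case: e => /= e /cards2P[a [b [ab ->]]].
rewrite subUset !sub1set !inE -!orbA => /andP[/or3P[] aE /or3P[] bE];
  move: ab; rewrite (eqP aE) (eqP bE) ?eqxx // => _;
  first [by constructor 1 | by constructor 1; rewrite setUC
        |by constructor 2 | by constructor 2; rewrite setUC
        |by constructor 3 | by constructor 3; rewrite setUC].
Qed.

Lemma forces_mono_exists k : exists N, forces_mono k N.
Proof.
have [->|k0] := posnP k.
  exists 2; apply/forall_inP => c _.
  have E : #|[set: 'I_2]| == 2 by rewrite cardsT card_ord.
  by case: (c (Sub [set: _] E : edge 'I_2)).
exists (ramsey_bound k); apply/forall_inP => c _.
pose f x y := if insub [set x; y] is Some e then c e else Ordinal k0.
have fE x y (e : edge _) : val e = [set x; y] -> f x y = c e.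
  by rewrite /f => <-; rewrite valK.
have [|||x [y [z [xy xz yz f1 f2]]]] := @ramsey_K3 _ _ f k setT setT.
- by rewrite cardsT card_ord.
- by rewrite cardsT card_ord.
- by move=> *; rewrite inE.
apply/set0Pn; exists [set x; y; z]; rewrite !inE; apply/andP; split.
  by rewrite -setUA cardsU1 cards2 !inE negb_or xy xz yz.
have cE e : e \in edges_in [set x; y; z] -> c e = f x y.
  by case/edges_in3 => /fE <- //; rewrite -?f1 -?f2.
by apply/forall_inP => e /cE->; apply/forall_inP => e' /cE->.
Qed.

Definition GR3 (k : nat) : nat := ex_minn (forces_mono_exists k).

(* Main.v *)
(** Upper bound: label the vertices by their residue modulo 5^j.  Between two
    labels use the triangle-free 2-colouring of K_5 at their lowest differing
    base-5 digit, with two fresh colours per digit, and inside each label an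
    optimal colouring with the remaining one or two colours.  All monochromatic
    triangles then lie inside the labels.  For n <= gallai_max k there are
    none, hence GR3 k > gallai_max k.

    Lower bound: by induction on k, a Gallai k-colouring of more than
    gallai_max k vertices has at least one monochromatic triangle if k is odd,
    and two if k is even.  If some Gallai partition has one colour between its
    parts, it can be merged into two parts that avoid this colour, up to one
    vertex.  Otherwise each part sees two colours outside, which it avoids, up
    to one vertex, and there are at most five parts since six representatives
    would span two monochromatic triangles.  Averaging over the subsets of
    size GR3 k concludes. *)

Require Import Defs.
From mathcomp Require Import all_boot all_order all_algebra zify.

Set Implicit Arguments.
Unset Strict Implicit.
Unset Printing Implicit Defensive.

(** * Gallai partitions *)

Section GallaiStructure.

Variables (T : finType) (f : T -> T -> nat).
Hypothesis fC : commutative f.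
Implicit Types (x y z u v w : T) (A V W X : {set T}) (p : T -> T) (a b : nat).

(** Triples with repeated vertices satisfy the disjunction by commutativity of [f], so diagonal
    values are harmless. *)
Definition no_rainbow V := {in V & &, forall x y z,
  [\/ f x y = f x z, f x y = f y z | f x z = f y z]}.

Lemma no_rainbowS V W :
  W \subset V -> no_rainbow V -> no_rainbow W.
Proof. by move=> /subsetP WV H x y z /WV xV /WV yV /WV; exact: H. Qed.

Definition color_rel V a : rel T :=
  [rel x y | [&& x \in V, y \in V, x != y & f x y == a]].

Lemma color_relE V a x y :
  color_rel V a x y = [&& x \in V, y \in V, x != y & f x y == a].
Proof. by []. Qed.

Definition color_conn V a : bool :=
  [forall x in V, forall y in V, connect (color_rel V a) x y].

Lemma color_connect_sym V a : connect_sym (color_rel V a).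
Proof.
apply: sym_connect_sym => x y.
by rewrite !color_relE fC [x == y]eq_sym andbCA.
Qed.

Lemma color_connect_mem V a x y :
  connect (color_rel V a) x y -> x \in V -> y \in V.
Proof.
case/connectP => p + ->; elim: p x => //= z p IHp x /andP[/and4P[_ zV _ _] pth] _.
exact: IHp.
Qed.

(** For an edge of colour [a] inside the component, the two edges from its ends to [y] avoid [a], so
    the triangle forces them to agree. *)
Lemma component_const V a x x' y : no_rainbow V -> x \in V -> y \in V ->
    connect (color_rel V a) x x' -> ~~ connect (color_rel V a) x y ->
  f x y = f x' y.
Proof.
move=> VG + yV /connectP[p + ->]; elim: p x => //= z p IHp x.
move=> xV /andP[xz pth] xy.
have zV : z \in V by case/and4P: xz.
have zy : ~~ connect (color_rel V a) z y.
  by apply: contra xy; apply: connect_trans; exact: connect1.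
have neq t : t \in V -> ~~ connect (color_rel V a) t y -> a <> f t y.
  move=> tV /negP ty fty; apply: ty; have [->//|ty] := eqVneq t y.
  by apply: connect1; rewrite color_relE tV yV ty -fty eqxx.
rewrite -(IHp z zV pth zy); case/and4P: xz => _ _ _ /eqP fxz.
have := neq _ xV xy; have := neq _ zV zy.
by case: (VG x z y xV zV yV); rewrite ?fxz.
Qed.

Lemma color_connect_nbr V a v x : color_conn V a -> v \in V -> x \in V :\ v ->
  exists2 y, y \in V :\ v & f v y = a.
Proof.
move=> /forall_inP Va vV; rewrite !inE => /andP[xv xV].
have /forall_inP/(_ x xV)/connectP[[|y p] /= pth lst] := Va v vV.
  by rewrite lst eqxx in xv.
case/andP: pth => /and4P[_ yV vy /eqP fvy] _.
by exists y; rewrite // !inE eq_sym vy.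
Qed.

(** Cut a path of colour [a] from [x] to [v] just before it first meets [v]. *)
Lemma component_nbr V a v x : color_conn V a -> v \in V -> x \in V :\ v ->
  exists y, [/\ y \in V :\ v, connect (color_rel (V :\ v) a) x y & f v y = a].
Proof.
move=> /forall_inP Va vV xW.
have /forall_inP/(_ v vV)/connectP[p] := Va x (subsetP (subsetDl _ _) _ xW).
elim: p x xW => [|z p IHp] x xW /=; first by move=> _ vx; rewrite vx !inE eqxx in xW.
move=> /andP[/and4P[_ zV xz /eqP fxz] pth] lst.
have [zv|zv] := eqVneq z v; first by exists x; split; rewrite // fC -zv.
have zW : z \in V :\ v by rewrite !inE zv.
have [y [yW zy fvy]] := IHp z zW pth lst.
exists y; split=> //; apply: connect_trans zy; apply: connect1.
by rewrite color_relE xW zW xz fxz eqxx.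
Qed.

(** If colour [a] falls apart on [V :\ v], then neighbours of [v] in colours [b] and [c] force
    [b = c], either on the edge between them or on their edges to a vertex of another component. *)
Lemma three_connected_step V a b c v : no_rainbow V -> v \in V ->
    a != b -> a != c -> b != c ->
    color_conn V a -> color_conn V b -> color_conn V c ->
  color_conn (V :\ v) a.
Proof.
move=> VG vV ab ac bc Va Vb Vc; apply: contraTT isT.
case/forall_inPn => x xW /forall_inPn[y yW xy].
have WG : no_rainbow (V :\ v) by apply: no_rainbowS VG; exact: subsetDl.
have WV := subsetP (subsetDl V [set v]).
pose e := color_rel (V :\ v) a.
(* The component of [z] contains a neighbour [u] of [v] in colour [a]. The triangle on [v], [t], [u]
   gives [f t u = d], and this component is uniform towards [t]. *)
have spread d t z : a != d -> t \in V :\ v -> f v t = d -> z \in V :\ v ->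
    ~~ connect e t z -> f t z = d.
  move=> ad tW fvt zW tz.
  have [u [uW zu fvu]] := component_nbr Va vV zW.
  have tu : ~~ connect e t u.
    by apply: contra tz => /connect_trans; apply; rewrite color_connect_sym.
  have fzu : f z t = f u t.
    by apply: component_const WG zW tW zu _; rewrite color_connect_sym.
  rewrite fC fzu fC; case: (VG v t u vV (WV _ tW) (WV _ uW)).
  - by rewrite fvt fvu => E; rewrite E eqxx in ad.
  - by rewrite fvt.
  rewrite fvu => E; case/negP: tu; apply: connect1; rewrite /e color_relE tW uW -E eqxx andbT.
  by apply: contraNneq ad => tu; rewrite -fvu -tu fvt.
have [s sW fvs] := color_connect_nbr Vb vV xW.
have [t tW fvt] := color_connect_nbr Vc vV xW.
have [st|st] := boolP (connect e s t); last first.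
  have := spread _ _ _ ac tW fvt sW; rewrite color_connect_sym => /(_ st).
  by rewrite fC (spread _ _ _ ab sW fvs tW st) => E; rewrite E eqxx in bc.
have [z zW sz] : exists2 z, z \in V :\ v & ~~ connect e s z.
  have [sx|sx] := boolP (connect e s x); last by exists x.
  exists y => //; apply: contra xy; apply: connect_trans.
  by rewrite color_connect_sym.
have tz : ~~ connect e t z by apply: contra sz; exact: connect_trans.
have := component_const WG sW zW st sz.
rewrite (spread _ _ _ ab sW fvs zW sz) (spread _ _ _ ac tW fvt zW tz) => E.
by rewrite E eqxx in bc.
Qed.

(** Deleting vertices keeps all three colours connected until two vertices remain, whose single edge
    cannot have two colours. *)
Lemma three_connected V a b c : no_rainbow V -> 1 < #|V| ->
    a != b -> a != c -> b != c ->
  ~~ [&& color_conn V a, color_conn V b & color_conn V c].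
Proof.
have [n] := ubnP #|V|; elim: n V => // n IHn V Vn VG V1 ab ac bc.
apply/and3P => -[Va Vb Vc].
have [v vV] : exists v, v \in V by apply/card_gt0P; exact: ltnW.
have := cardsD1 v V; rewrite vV add1n => VE.
have WG : no_rainbow (V :\ v) by apply: no_rainbowS VG; exact: subsetDl.
have [W1|W1] := ltnP 1 #|V :\ v|.
  have Wn : #|V :\ v| < n by rewrite -VE.
  have /and3P[] := IHn (V :\ v) Wn WG W1 ab ac bc; split.
  - exact: three_connected_step VG vV ab ac bc Va Vb Vc.
  - by apply: three_connected_step VG vV _ bc ac Vb Va Vc; rewrite eq_sym.
  - by apply: three_connected_step VG vV _ _ ab Vc Va Vb; rewrite eq_sym.
have /cards1P[w WE] : #|V :\ v| == 1 by rewrite eqn_leq W1 -ltnS -VE.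
have wW : w \in V :\ v by rewrite WE set11.
have [s + fvs] := color_connect_nbr Va vV wW.
have [t + fvt] := color_connect_nbr Vb vV wW.
rewrite WE !inE => /eqP tE /eqP sE.
by move: ab; rewrite -fvs -fvt tE sE eqxx.
Qed.

(* The fibres of [p] on [V] are the parts of a Gallai partition of [V]. *)
Definition gallai_label V p a b : Prop :=
  [/\ {in V &, forall x y, p x != p y -> f x y = a \/ f x y = b},
      {in V & &, forall x x' y, p x = p x' -> p x != p y -> f x y = f x' y} &
      exists x y, [/\ x \in V, y \in V & p x != p y]].

(** With at most two colours, take singletons as parts. Otherwise some colour is disconnected by
    [three_connected]; contracting its components to their roots gives a smaller Gallai colouring,
    whose partition pulls back. *)
Lemma gallai_partition V : no_rainbow V -> 1 < #|V| -> exists p a b, gallai_label V p a b.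
Proof.
have [n] := ubnP #|V|; elim: n V => // n IHn V Vn VG V1.
have two a b :
    (forall x y, x \in V -> y \in V -> x != y -> f x y = a \/ f x y = b) ->
  exists p a b, gallai_label V p a b.
  move=> Vab; exists id, a, b; split=> [x y|x x' y _ _ _ -> //|]; first exact: Vab.
  by have /card_gt1P[x [y [xV yV xy]]] := V1; exists x, y.
have [x0 [y0 [x0V y0V xy0]]] := card_gt1P V1.
have other a b : (forall x y, x \in V -> y \in V -> x != y -> f x y = a \/ f x y = b) \/
    exists c, [/\ a != c, b != c & exists x y, [/\ x \in V, y \in V, x != y & f x y = c]].
  have [H|] := boolP [forall x in V, forall y in V,
      (x != y) ==> ((f x y == a) || (f x y == b))].
    left=> x y xV yV xy; move/forall_inP/(_ x xV)/forall_inP/(_ y yV): H.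
    by rewrite xy => /orP[/eqP|/eqP]; [left|right].
  case/forall_inPn => x xV /forall_inPn[y yV].
  rewrite negb_imply negb_or => /and3P[xy fa fb]; right; exists (f x y).
  by rewrite ![_ == f x y]eq_sym; split=> //; exists x, y.
pose a := f x0 y0.
have [/two //|[b [ab _ usedb]]] := other a a.
have [/two //|[c [ac bc usedc]]] := other a b.
(* An edge of colour [d] makes the contraction strictly smaller, and disconnectedness leaves it at
   least two vertices. *)
have [d [x1 [y1 [x1V y1V xy1 fd]]] Vd] : exists2 d,
    exists x y, [/\ x \in V, y \in V, x != y & f x y = d] & ~~ color_conn V d.
  have := three_connected VG V1 ab ac bc; rewrite !negb_and.
  by case/or3P => ?; [exists a; rewrite // /a; exists x0, y0 | exists b | exists c].
pose e := color_rel V d; pose q := fingraph.root e.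
have eC : connect_sym e := color_connect_sym V d.
have qV x : x \in V -> q x \in V.
  by apply: color_connect_mem; exact: connect_root.
have qf x y : x \in V -> y \in V -> q x != q y -> f x y = f (q x) (q y).
  move=> xV yV qxy; have nxy : ~~ connect e x y by rewrite -(root_connect eC).
  rewrite (component_const VG xV yV (connect_root e x) nxy) ![f (q x) _]fC.
  apply: component_const VG yV (qV _ xV) (connect_root e y) _.
  by rewrite eC; apply: contra nxy; apply: connect_trans; exact: connect_root.
pose X := q @: V.
have XV : X \subset V by apply/subsetP => _ /imsetP[x xV ->]; exact: qV.
have Xn : #|X| < n.
  rewrite -ltnS; apply: leq_trans Vn; rewrite ltnS ltn_neqAle leq_imset_card andbT.
  apply: contra (xy1) => /imset_injP/(_ x1 y1 x1V y1V) qxy; apply/eqP/qxy/(fingraph.rootP eC).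
  by apply: connect1; rewrite /e color_relE x1V y1V xy1 fd eqxx.
have X1 : 1 < #|X|.
  case/forall_inPn: Vd => x xV /forall_inPn[y yV xy]; apply/card_gt1P.
  exists (q x), (q y); rewrite !imset_f //; split=> //.
  by rewrite (root_connect eC).
have [p [a' [b' [pab pmod [_ [_ [/imsetP[x xV ->] /imsetP[y yV ->] pxy]]]]]]] :=
  IHn X Xn (no_rainbowS XV VG) X1.
have pq u v : p (q u) != p (q v) -> q u != q v by apply: contraNneq => ->.
exists (p \o q), a', b'; split=> [u v uV vV /= puv|u u' v uV u'V vV /= puu' puv|].
- by rewrite qf ?pq //; apply: pab; rewrite ?imset_f.
- rewrite qf ?[f u' v]qf ?pq -?puu' //.
  by apply: pmod; rewrite ?imset_f.
by exists x, y.
Qed.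

(** * Monochromatic triangles in large Gallai colourings *)

Definition monotri V : {set {set T}} :=
  [set A | [exists x in V, exists y in V, exists z in V,
    [&& x != y, x != z, y != z, f x y == f x z, f x y == f y z
      & A == [set x; y; z]]]].

Lemma monotriP V A : A \in monotri V -> exists x y z,
  [/\ [/\ x \in V, y \in V & z \in V], [/\ x != y, x != z & y != z],
      f x y = f x z, f x y = f y z & A = [set x; y; z]].
Proof.
rewrite inE => /exists_inP[x xV /exists_inP[y yV /exists_inP[z zV]]].
by case/and5P=> xy xz yz /eqP fy /andP[/eqP fz /eqP AE]; exists x, y, z.
Qed.

Lemma mem_monotri V x y z : x \in V -> y \in V -> z \in V ->
    x != y -> x != z -> y != z -> f x y = f x z -> f x y = f y z ->
  [set x; y; z] \in monotri V.
Proof.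
move=> xV yV zV xy xz yz fy fz; rewrite inE.
apply/exists_inP; exists x => //; apply/exists_inP; exists y => //.
apply/exists_inP; exists z => //.
by rewrite xy xz yz fy eqxx -{1}fy fz !eqxx.
Qed.

Lemma monotri_sub V A : A \in monotri V -> A \subset V.
Proof.
case/monotriP => x [y [z [[xV yV zV] _ _ _ ->]]].
by apply/subsetP => t; rewrite !inE -orbA => /or3P[] /eqP->.
Qed.

Lemma monotri_restrict V W A : A \in monotri V -> A \subset W -> A \in monotri W.
Proof.
case/monotriP => x [y [z [_ [xy xz yz] fy fz ->]]] /subsetP AW.
by apply: mem_monotri; rewrite // AW // !inE eqxx ?orbT.
Qed.

Lemma monotriS V W : W \subset V -> monotri W \subset monotri V.
Proof.
move=> WV; apply/subsetP => A AW; apply: monotri_restrict (AW) _.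
exact: subset_trans (monotri_sub AW) WV.
Qed.

(* Goodman's count: a vertex with [p] edges of one colour and [5 - p] of the
   other is the apex of [p * (5 - p) <= 6] bichromatic cherries, and each of
   the 20 triangles that is not monochromatic contains two of them. *)
Lemma goodman6 X a b : 6 <= #|X| ->
    {in X &, forall x y, x != y -> f x y = a \/ f x y = b} ->
  1 < #|monotri X|.
Proof.
wlog X6 : X / #|X| = 6 => [wl X6 Xab|_ Xab].
  have : 0 < #|[set Y : {set T} | (Y \subset X) && (#|Y| == 6)]|.
    by rewrite cards_draws bin_gt0.
  case/card_gt0P => Y; rewrite inE => /andP[YX /eqP Y6].
  apply: leq_trans (subset_leq_card (monotriS YX)).
  apply: wl => // [|x y /(subsetP YX) xX /(subsetP YX)]; first by rewrite Y6.
  exact: Xab.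
pose NA x := [set y in X :\ x | f x y == a].
pose NB x := [set y in X :\ x | f x y != a].
(* Cherries are triples: apex, end in colour [a], end in the other colour. *)
pose S := [set t : T * (T * T) | (t.1 \in X) && (t.2 \in setX (NA t.1) (NB t.1))].
pose g (t : T * (T * T)) := [set t.1; t.2.1; t.2.2].
have S36 : #|S| <= 36.
  have -> : #|S| = \sum_(x in X) #|setX (NA x) (NB x)|.
    rewrite -sum1_card; under [in RHS]eq_bigr do rewrite -sum1_card.
    by rewrite pair_big_dep; apply: eq_bigl => t; rewrite inE.
  have -> : 36 = \sum_(x in X) 6 by rewrite sum_nat_const X6.
  apply: leq_sum => x xX; rewrite cardsX.
  have : #|NA x| + #|NB x| = 5.
    have <- : #|X :\ x| = 5 by have := cardsD1 x X; rewrite xX X6; lia.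
    rewrite -(cardsID [set y | f x y == a] (X :\ x)); congr (_ + _).
      by apply: eq_card => y; rewrite !inE.
    by apply: eq_card => y; rewrite !inE andbC.
  by move: #|NA x| #|NB x| => [|[|[|[|[|[|p]]]]]] q; lia.
(* Besides the cherry at [x] there is one at [z] if [f y z = a], and one at [y] otherwise. *)
have fib x y z : x \in X -> y \in X -> z \in X -> x != y -> x != z -> y != z ->
    f x y = a -> f x z <> a -> 1 < #|[set t in S | g t == [set x; y; z]]|.
  move=> xX yX zX xy xz yz fxy /eqP fxz; apply/card_gt1P; exists (x, (y, z)).
  have [fyz|fyz] := eqVneq (f y z) a.
    exists (z, (y, x)); rewrite !inE /g /= ![z == _]eq_sym ![y == x]eq_sym.
    rewrite !xX yX zX xy xz yz [f z y]fC [f z x]fC fxy fyz (negPf fxz) !eqxx /=.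
    split=> //; last by apply: contraNneq xz => -[->].
    by apply/eqP/setP => t; rewrite !inE; do 3!case: (t == _).
  exists (y, (x, z)); rewrite !inE /g /= ![z == _]eq_sym ![y == x]eq_sym.
  rewrite !xX yX zX xy xz yz [f y x]fC fxy (negPf fxz) (negPf fyz) !eqxx /=.
  split=> //; last by apply: contraNneq xy => -[->].
  by rewrite [[set y; x]]setUC.
pose N := [set A : {set T} | (A \subset X) && (#|A| == 3)] :\: monotri X.
have fibN A : A \in N -> 1 < #|[set t in S | g t == A]|.
  rewrite !inE => /and3P[+ AX /eqP/card3E[x [y [z [xy xz yz AE]]]]].
  move: AX; rewrite {}AE !subUset !sub1set -andbA => /and3P[xX yX zX] nM.
  have yx : y != x by rewrite eq_sym. have zx : z != x by rewrite eq_sym.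
  have zy : z != y by rewrite eq_sym.
  have nmono : f x y = f x z -> f x y <> f y z.
    move=> fy fz; move: nM.
    by have := mem_monotri xX yX zX xy xz yz fy fz; rewrite inE => ->.
  have e1 : [set x; z; y] = [set x; y; z] by rewrite setUAC.
  have e2 : [set y; x; z] = [set x; y; z] by rewrite [[set y; x]]setUC.
  have e3 : [set y; z; x] = [set x; y; z] by rewrite setUAC e2.
  (* Each case renames the vertices so that the first one is the apex of a cherry. *)
  have [fxy|/eqP fxy] := eqVneq (f x y) a; have [fxz|/eqP fxz] := eqVneq (f x z) a.
  - by rewrite -e2; apply: fib; rewrite // 1?fC // => fyz; apply: nmono; congruence.
  - exact: fib.
  - by rewrite -e1; apply: fib.
  have fyz : f y z = a.
    have := nmono; case: (Xab _ _ xX yX xy) => // ->.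
    case: (Xab _ _ xX zX xz) => // ->.
    by case: (Xab _ _ yX zX yz) => // -> /(_ erefl).
  by rewrite -e3; apply: fib; rewrite // fC.
have N36 : #|N| * 2 <= 36.
  apply: leq_trans S36; rewrite -sum_nat_const -(sum1_card (mem S)).
  rewrite (partition_big g xpredT) //= [leqRHS](bigID (mem N)) /=.
  apply: leq_trans (leq_addr _ _); apply: leq_sum => A /fibN.
  by rewrite -sum1_card; under eq_bigl do rewrite inE.
have : 'C(6, 3) <= #|monotri X| + #|N|.
  rewrite -X6 -cards_draws -(cardsID (monotri X) [set A | _ & _]) leq_add2r.
  by apply: subset_leq_card; apply: subsetIr.
by move: N36; rewrite (_ : 'C(6, 3) = 20) //; lia.
Qed.

(** * Gallai partitions with few monochromatic triangles *)

Definition inner_free p a b W : Prop :=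
  {in W &, forall x y, x != y -> p x = p y -> f x y != a /\ f x y != b}.

(* An edge of colour [a] or [b] inside a part spans a monochromatic triangle
   with every vertex of some other part.  If only one such triangle is allowed,
   deleting an end of that edge kills it, and the other part is a singleton. *)
Lemma monotri_hitting V p a b (e : bool) x0 :
    gallai_label V p a b -> x0 \in V ->
    {in V, forall x d, d \in [:: a; b] ->
      exists y, [/\ y \in V, p x != p y & f x y = d]} ->
    #|monotri V| <= e ->
  exists W, [/\ W \subset V, #|V| <= #|W| + e, monotri W = set0,
    inner_free p a b W &
    inner_free p a b V \/
      exists2 w, w \in W & {in V, forall y, p y = p w -> y = w}].
Proof.
move=> [_ pmod _] x0V sees Me.
have cone x y : x \in V -> y \in V -> x != y -> p x = p y -> f x y \in [:: a; b] ->
    exists w, [/\ w \in V, p x != p w &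
      {in V, forall z, p z = p w -> [set x; y; z] \in monotri V}].
  move=> xV yV xy pxy fd; have [w [wV pxw fxw]] := sees x xV _ fd.
  exists w; split=> // z zV pzw.
  have fxz : f x z = f x y.
    by rewrite -fxw fC [RHS]fC; apply: pmod; rewrite // pzw eq_sym.
  have xz : x != z by apply: contraNneq pxw => ->; rewrite pzw.
  have yz : y != z by apply: contraNneq pxw => yz; rewrite pxy yz pzw.
  apply: mem_monotri => //.
  by rewrite -fxz; apply: pmod; rewrite // pzw.
have [H|] := boolP [forall x in V, forall y in V,
    (x != y) ==> (p x == p y) ==> (f x y \notin [:: a; b])].
  have Vfree : inner_free p a b V.
    move=> x y xV yV xy pxy; move/forall_inP/(_ x xV)/forall_inP/(_ y yV): H.
    by rewrite xy pxy eqxx !inE negb_or => /andP[].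
  have Wfree W : W \subset V -> inner_free p a b W.
    by move=> /subsetP WV x y /WV xV /WV; exact: Vfree.
  have [M0|[A AM]] := set_0Vmem (monotri V).
    by exists V; split; rewrite ?leq_addr //; left.
  have e1 : e by case: (e) Me => //; rewrite leqn0 cards_eq0 => /eqP M0; rewrite M0 inE in AM.
  rewrite e1 in Me *.
  have [u [y [z [[uV _ _] _ _ _ AE]]]] := monotriP AM.
  exists (V :\ u); split; rewrite ?subsetDl //.
  - by rewrite (cardsD1 u V) uV addnC.
  - apply/setP => B; rewrite in_set0; apply/negbTE/negP => BM.
    have BE : B = A.
      apply: (card_le1_eqP Me) => //.
      by apply: (subsetP (monotriS _)) BM; exact: subsetDl.
    move: (subsetP (monotri_sub BM) u); rewrite BE AE !inE eqxx /=.
    by move=> /(_ isT).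
  - by apply: Wfree; exact: subsetDl.
  by left.
case/forall_inPn => x xV /forall_inPn[y yV].
rewrite 2!negb_imply negbK => /and3P[xy /eqP pxy fd].
have [w [wV pxw xyw]] := cone x y xV yV xy pxy fd.
have e1 : e.
  case: (e) Me => //; rewrite leqn0 cards_eq0 => /eqP M0.
  by have := xyw w wV erefl; rewrite M0 inE.
rewrite e1 in Me *.
have uniqM A : A \in monotri V -> A = [set x; y; w].
  by move=> AM; apply: (card_le1_eqP Me) => //; exact: xyw.
have WV : V :\ x \subset V by exact: subsetDl.
exists (V :\ x); split=> //.
- by rewrite (cardsD1 x V) xV addnC.
- apply/setP => B; rewrite in_set0; apply/negbTE/negP => BM.
  have := subsetP (monotri_sub BM) x.
  rewrite (uniqM B); last exact: (subsetP (monotriS WV)).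
  by rewrite !inE eqxx /= => /(_ isT).
(* Another such inner edge from [s] to [t] would span the same triangle, hence join [y] and [w],
   which lie in different parts. *)
- move=> s t sW tW st pst; apply/andP; rewrite -negb_or.
  apply/negP => sab.
  have [|v [vV _ /(_ v vV erefl) /uniqM stv]] :=
    cone s t (subsetP WV _ sW) (subsetP WV _ tW) st pst.
    by rewrite !inE.
  have : s \in [set x; y; w] by rewrite -stv !inE eqxx.
  have : t \in [set x; y; w] by rewrite -stv !inE eqxx orbT.
  move: sW tW; rewrite !inE => /andP[/negPf-> _] /andP[/negPf-> _] /=.
  move=> /orP[]/eqP tE /orP[]/eqP sE; move: st pst pxw; rewrite tE sE ?eqxx // -?pxy //.
  - by move=> _ ->; rewrite eqxx.
  - by move=> _ <-; rewrite eqxx.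
right; exists w.
  by rewrite !inE wV andbT; apply: contraNneq pxw => ->.
move=> z zV pzw; have := uniqM _ (xyw z zV pzw).
have : z \in [set x; y; z] by rewrite !inE eqxx orbT.
move=> + E; rewrite E !inE -orbA => /or3P[]/eqP // zE.
  by rewrite -zE pzw eqxx in pxw.
by rewrite pxy -zE pzw eqxx in pxw.
Qed.

Lemma card_fibres_le p V F :
    {in V, forall x, #|[set y in V | p y == p x]| <= F} ->
  #|V| <= #|p @: V| * F.
Proof.
move=> H; rewrite -sum1_card (partition_big_imset p) -sum_nat_const /=.
apply: leq_sum => _ /imsetP[x xV ->]; apply: leq_trans (H x xV).
by rewrite -sum1_card; apply/eq_leq/eq_bigl => y; rewrite inE.
Qed.

(** One representative per part gives a set coloured by [a] and [b] alone, to which [goodman6]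
    applies. *)
Lemma gallai_label_parts V p a b :
  gallai_label V p a b -> #|monotri V| <= 1 -> #|p @: V| <= 5.
Proof.
move=> [pab _ _] M1; rewrite leqNgt; apply/negP => six.
pose h c := odflt c [pick x in V | p x == c].
have hV c : c \in p @: V -> h c \in V /\ p (h c) = c.
  case/imsetP => x xV cE; rewrite /h; case: pickP => [y /andP[yV /eqP] //|].
  by move/(_ x); rewrite xV cE eqxx.
pose X := h @: (p @: V).
have XV : X \subset V by apply/subsetP => _ /imsetP[c /hV[]] + _ ->.
have cX : #|X| = #|p @: V|.
  by apply: card_in_imset => c d /hV[_ cE] /hV[_ dE] hcd; rewrite -cE -dE hcd.
suff : 1 < #|monotri X|.
  by rewrite ltnNge (leq_trans (subset_leq_card (monotriS XV)) M1).
apply: (@goodman6 X a b); first by rewrite cX.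
move=> _ _ /imsetP[c /hV[cV cE] ->] /imsetP[d /hV[dV dE] ->] hcd.
by apply: pab; rewrite // cE dE; apply: contraNneq hcd => ->.
Qed.
(** If [a = b], or if some vertex misses one of them outside its part, then that part and the rest
    of [V] form a two-part partition in a single colour. *)
Lemma gallai_label_cases V p a b : gallai_label V p a b ->
  (exists p' d, gallai_label V p' d d /\ #|p' @: V| <= 2) \/
  (a != b /\ {in V, forall x d, d \in [:: a; b] ->
     exists y, [/\ y \in V, p x != p y & f x y = d]}).
Proof.
move=> Vp; have [pab _ [x0 [y0 [x0V y0V pxy0]]]] := Vp.
have cut x d : x \in V -> (exists2 y, y \in V & p x != p y) ->
    {in V, forall y, p x != p y -> f x y = d} ->
    exists p' d, gallai_label V p' d d /\ #|p' @: V| <= 2.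
  move=> xV [y yV pxy] fxd; pose p' z := if p z == p x then x else y.
  have xy : x != y by apply: contraNneq pxy => ->.
  have p'E u v : u \in V -> v \in V -> p' u != p' v -> f u v = d.
    move=> uV vV; have [_ pmod _] := Vp; rewrite /p'.
    have [pu|pu] := eqVneq (p u) (p x);
      have [pv|pv] := eqVneq (p v) (p x); rewrite ?eqxx // => _.
      by rewrite (pmod u x v) ?pu // 1?eq_sym // fxd // eq_sym.
    by rewrite fC (pmod v x u) ?pv // 1?eq_sym // fxd // eq_sym.
  exists p', d; split; last first.
    have sub : p' @: V \subset [set x; y].
      by apply/subsetP => _ /imsetP[z _ ->]; rewrite /p' !inE; case: ifP; rewrite eqxx ?orbT.
    by apply: leq_trans (subset_leq_card sub) _; rewrite cards2; case: (_ != _).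
  split=> [u v uV vV puv|u u' v uV u'V vV puu' puv|].
  - by left; exact: p'E.
  - by rewrite !p'E -?puu'.
  by exists x, y; rewrite /p' eqxx [p y == _]eq_sym (negPf pxy).
have [ab|ab] := eqVneq a b.
  left; apply: (cut x0 a) => // [|y yV pxy]; first by exists y0.
  by case: (pab x0 y x0V yV pxy); rewrite -?ab.
have [H|] := boolP [forall x in V,
    all (fun d => [exists y in V, (p x != p y) && (f x y == d)]) [:: a; b]].
  right; split=> // x xV d dab; move/forall_inP/(_ x xV)/allP/(_ d dab): H.
  by case/exists_inP => y yV /andP[pxy /eqP]; exists y.
case/forall_inPn => x xV /allPn[d dab /exists_inPn nd]; left.
have [y yV pxy] : exists2 y, y \in V & p x != p y.
  have [pxx|] := eqVneq (p x) (p x0); last by exists x0.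
  by exists y0; rewrite // pxx.
have {}nd z : z \in V -> p x != p z -> f x z <> d.
  by move=> zV pxz; move: (nd z zV); rewrite pxz => /eqP.
move: dab; rewrite !inE => /orP[]/eqP dE.
  apply: (cut x b) => // [|z zV pxz]; first by exists y.
  by case: (pab x z xV zV pxz) => // fa; case: (nd z zV pxz); rewrite dE.
apply: (cut x a) => // [|z zV pxz]; first by exists y.
by case: (pab x z xV zV pxz) => // fa; case: (nd z zV pxz); rewrite dE.
Qed.

End GallaiStructure.

(** The largest order of a Gallai [k]-colouring without monochromatic triangles, that is,
    [GR3 k - 1]. *)
Definition gallai_max (k : nat) : nat :=
  if odd k then 2 * 5 ^ k./2 else 5 ^ k./2.

Lemma gallai_max_gt0 k : 0 < gallai_max k.
Proof. by rewrite /gallai_max; case: ifP => _; rewrite ?muln_gt0 expn_gt0. Qed.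

Lemma gallai_maxSS k : gallai_max k.+2 = 5 * gallai_max k.
Proof. by rewrite /gallai_max /= negbK expnS; case: ifP => _; lia. Qed.

(** The slack [odd k] pays for the vertex that may be deleted before the split into two parts. *)
Lemma gallai_maxS k : 2 * gallai_max k + odd k <= gallai_max k.+1.
Proof.
rewrite /gallai_max /=; have : 0 < 5 ^ k./2 by rewrite expn_gt0.
by rewrite uphalf_half; case: (odd k); rewrite ?add0n ?add1n ?expnS /=; lia.
Qed.

Lemma gallai_max_gt1 k : 0 < k -> 1 < gallai_max k.
Proof.
case: k => // k _; apply: leq_trans (gallai_maxS k).
by have := gallai_max_gt0 k; lia.
Qed.

Lemma size_rem_mem (C : seq nat) d : d \in C -> (size (rem d C)).+1 = size C.
Proof. by move=> dC; rewrite size_rem // prednK //; case: C dC. Qed.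

Lemma mem_rem_neq (C : seq nat) c d : c \in C -> c != d -> c \in rem d C.
Proof.
move=> cC cd; have [dC|/rem_id -> //] := boolP (d \in C).
by move: cC; rewrite (perm_mem (perm_to_rem dC)) inE (negPf cd).
Qed.

(** The colours form a list so that the induction can remove one or two of them. Removing two
    preserves the parity, hence the guaranteed number of triangles. *)
Lemma gallai_monotri (T : finType) (f : T -> T -> nat) (fC : commutative f)
    k (V : {set T}) (C : seq nat) :
    size C <= k -> gallai_max k < #|V| -> no_rainbow f V ->
    {in V &, forall x y, x != y -> f x y \in C} ->
  ~~ odd k < #|monotri f V|.
Proof.
have [n] := ubnP k; elim: n k V C => // n IHn k V C kn Ck Vk VG VC.
rewrite ltnNge; apply/negP => Me.
have V1 : 1 < #|V| by apply: leq_trans Vk; rewrite ltnS gallai_max_gt0.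
have x0V : exists x0, x0 \in V by apply/card_gt0P; exact: ltnW.
have {x0V} [x0 x0V] := x0V.
have M1 : #|monotri f V| <= 1 by apply: leq_trans Me _; case: (odd k).
have [p [a [b Vp]]] := gallai_partition fC VG V1.
case: (gallai_label_cases fC Vp) => [|[ab sees]].
  case=> {Vp}p [d [Vp p2]]; have [pd _ [x1 [y1 [x1V y1V pxy1]]]] := Vp.
  have fd x y : x \in V -> y \in V -> p x != p y -> f x y = d.
    by move=> xV yV pxy; case: (pd x y xV yV pxy).
  have dC : d \in C.
    by rewrite -(fd x1 y1) // VC //; apply: contraNneq pxy1 => ->.
  have sees x : x \in V -> forall d', d' \in [:: d; d] ->
      exists y, [/\ y \in V, p x != p y & f x y = d'].
    move=> xV d'; rewrite !inE orbb => /eqP->.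
    have [y yV pxy] : exists2 y, y \in V & p x != p y.
      have [pxx|] := eqVneq (p x) (p x1); last by exists x1.
      by exists y1; rewrite // pxx.
    by exists y; rewrite fd.
  have [W [WV VW W0 Wfree _]] := monotri_hitting fC Vp x0V sees Me.
  case: k => [|k] in kn Ck Vk Me VW *.
    by move: Ck dC; rewrite leqn0 => /nilP->.
  (* A fibre has no monochromatic triangle and avoids [d], so the induction hypothesis for one
     colour less bounds it. *)
  have fib : {in W, forall x, #|[set y in W | p y == p x]| <= gallai_max k}.
    move=> x xW; rewrite leqNgt; apply/negP => big.
    have RW : [set y in W | p y == p x] \subset W.
      by apply/subsetP => y; rewrite inE => /andP[].
    have R0 : monotri f [set y in W | p y == p x] = set0.
      by apply/eqP; rewrite -subset0 -W0; exact: monotriS.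
    suff : ~~ odd k < #|monotri f [set y in W | p y == p x]| by rewrite R0 cards0.
    apply: (IHn k _ (rem d C)) => //.
    - by rewrite -ltnS size_rem_mem.
    - exact: no_rainbowS (subset_trans RW WV) VG.
    - move=> y z; rewrite !inE => /andP[yW /eqP py] /andP[zW /eqP pz] yz.
      rewrite mem_rem_neq ?VC ?(subsetP WV) //.
      by have [] := Wfree y z yW zW yz; rewrite ?py ?pz.
  have W2 : #|W| <= 2 * gallai_max k.
    apply: leq_trans (card_fibres_le fib) _; rewrite leq_mul2r.
    by rewrite (leq_trans (subset_leq_card (imsetS p WV)) p2) orbT.
  by have := gallai_maxS k; move: VW Vk W2; rewrite /= negbK; lia.
have [W [WV VW _ Wfree sing]] := monotri_hitting fC Vp x0V sees Me.
have p5 := gallai_label_parts fC Vp M1.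
have used d : d \in [:: a; b] -> d \in C.
  move=> dab; have [y [yV pxy <-]] := sees x0 x0V d dab.
  by rewrite VC //; apply: contraNneq pxy => ->.
have aC : a \in C by rewrite used // inE eqxx.
have bC : b \in rem a C by rewrite mem_rem_neq ?used // ?inE ?eqxx ?orbT // eq_sym.
have CE := size_rem_mem aC; have CE' := size_rem_mem bC.
case: k => [|[|k]] in kn Ck Vk Me VW *; try by move: Ck; rewrite -CE -CE'.
(* Fibres may keep triangles here: for two colours less, the induction hypothesis would still give
   more triangles than [V] has. *)
have fib (Z : {set T}) : Z \subset V -> inner_free f p a b Z ->
    {in Z, forall x, #|[set y in Z | p y == p x]| <= gallai_max k}.
  move=> ZV Zfree x xZ; rewrite leqNgt; apply/negP => big.
  have RZ : [set y in Z | p y == p x] \subset Z.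
    by apply/subsetP => y; rewrite inE => /andP[].
  have RV := subset_trans RZ ZV.
  suff : ~~ odd k < #|monotri f [set y in Z | p y == p x]|.
    rewrite ltnNge (leq_trans (subset_leq_card (monotriS f RV))) //.
    by move: Me; rewrite /= negbK.
  apply: (IHn k _ (rem b (rem a C))) => //.
  - exact: ltnW.
  - by rewrite -2!ltnS CE' CE.
  - exact: no_rainbowS RV VG.
  - move=> y z; rewrite !inE => /andP[yZ /eqP py] /andP[zZ /eqP pz] yz.
    have [] := Zfree y z yZ zZ yz; rewrite ?py ?pz // => fa fb.
    by rewrite !mem_rem_neq ?VC ?(subsetP ZV).
have F5 (Z : {set T}) : Z \subset V -> #|p @: Z| * gallai_max k <= 5 * gallai_max k.
  by move=> ZV; rewrite leq_mul2r (leq_trans (subset_leq_card (imsetS p ZV)) p5) orbT.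
move: Vk; rewrite gallai_maxSS ltnNge => /negP; case.
case: sing => [Vfree|[w wW wp]].
  exact: leq_trans (card_fibres_le (fib V (subxx _) Vfree)) (F5 _ (subxx _)).
have WwW : W :\ w \subset W by exact: subsetDl.
have Wwfree : inner_free f p a b (W :\ w).
  by move=> x y /(subsetP WwW) xW /(subsetP WwW); exact: Wfree.
(* The part of [w] is a singleton, so [W :\ w] meets at most four parts. *)
have p4 : #|p @: (W :\ w)| <= 4.
  rewrite -ltnS (leq_trans _ p5) // (cardsD1 (p w) (p @: V)).
  rewrite (imset_f p (subsetP WV _ wW)) ltnS; apply: subset_leq_card.
  apply/subsetP => _ /imsetP[z zWw ->]; move: zWw; rewrite !inE => /andP[zw zW].
  rewrite imset_f ?(subsetP WV) // andbT; apply: contraNneq zw => /wp -> //.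
  exact: (subsetP WV).
have W4 : #|W :\ w| <= 4 * gallai_max k.
  apply: leq_trans (card_fibres_le (fib _ (subset_trans WwW WV) Wwfree)) _.
  by rewrite leq_mul2r p4 orbT.
have WE := cardsD1 w W; rewrite wW in WE.
(* At most two vertices of [V] lie outside [W :\ w], and [2 <= gallai_max k] when [0 < k]. For
   [k = 0] only the colours [a] and [b] occur, and [goodman6] applies to six vertices. *)
have [k0|k0] := posnP k; last first.
  have V2 : #|V| <= #|W :\ w| + 2.
    by apply: leq_trans VW _; rewrite WE -addnA addnCA leq_add2l; case: (~~ _).
  apply: leq_trans V2 _; have := gallai_max_gt1 k0; move: W4.
  by move: (gallai_max k) #|_| => F N; lia.
rewrite k0 in Ck *; rewrite leqNgt; apply/negP => V6.
have := goodman6 (a := a) (b := b) fC V6; rewrite ltnNge M1; case/(_ _)/negP => //.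
move=> x y xV yV xy; have fxyC := VC x y xV yV xy.
have [fa|fa] := eqVneq (f x y) a; [by left | right].
apply/eqP/negPn/negP => fb.
have := size_rem_mem (mem_rem_neq (mem_rem_neq fxyC fa) fb).
by move=> CE''; move: Ck; rewrite -CE -CE' -CE''.
Qed.
(** * Colourings as functions of two vertices *)

(** Colours become natural numbers, so that restricting vertices or removing colours changes no
    type; the diagonal of [f] is left free. *)
Definition agrees (k : nat) (T : finType) (c : coloring k T) (f : T -> T -> nat) :=
  forall x y (e : edge T), val e = [set x; y] -> f x y = c e.

Lemma edge_exists (T : finType) (x y : T) :
  x != y -> exists e : edge T, val e = [set x; y].
Proof.
move=> xy; have xy2 : #|[set x; y]| == 2 by rewrite cards2 xy.
by exists (Sub [set x; y] xy2).
Qed.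

Lemma set2_eq (T : finType) (x y u v : T) : x != y -> [set x; y] = [set u; v] ->
  (x = u /\ y = v) \/ (x = v /\ y = u).
Proof.
move=> xy E; have : x \in [set u; v] by rewrite -E !inE eqxx.
have : y \in [set u; v] by rewrite -E !inE eqxx orbT.
rewrite !inE => /orP[]/eqP yE /orP[]/eqP xE; move: xy; rewrite xE yE ?eqxx //.
  by right.
by left.
Qed.

Lemma coloring_of_fun (k : nat) (T : finType) (f : T -> T -> nat) :
    commutative f -> (forall x y, x != y -> f x y < k) ->
  exists c : coloring k T, agrees c f.
Proof.
move=> fC fk.
have ch (e : edge T) : exists i : 'I_k, forall x y, val e = [set x; y] -> f x y = i.
  have /cards2P[u [v [uv eE]]] := valP e.
  exists (Ordinal (fk u v uv)) => x y; rewrite eE => /(set2_eq uv)[][<- <-] //=.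
have [c cP] := fin_all_exists ch.
by exists (finfun c) => x y e eE; rewrite ffunE (cP e).
Qed.

Lemma fun_of_coloring (k : nat) (T : finType) (c : coloring k T) :
  exists2 f, commutative f & agrees c f.
Proof.
exists (fun x y => if insub [set x; y] is Some e then nat_of_ord (c e) else 0).
  by move=> x y; rewrite setUC.
by move=> x y e <-; rewrite valK.
Qed.

Section Agrees.

Variables (k : nat) (T : finType) (c : coloring k T) (f : T -> T -> nat).
Hypotheses (fC : commutative f) (cf : agrees c f).

Lemma triangle_edges x y z : x != y -> x != z -> y != z ->
  exists e1 e2 e3 : edge T,
  [/\ [/\ val e1 = [set x; y], val e2 = [set x; z] & val e3 = [set y; z]],
      [/\ e1 \in edges_in [set x; y; z], e2 \in edges_in [set x; y; z]
        & e3 \in edges_in [set x; y; z]] &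
      [/\ e1 != e2, e1 != e3 & e2 != e3]].
Proof.
move=> xy xz yz.
have [e1 E1] := edge_exists xy; have [e2 E2] := edge_exists xz.
have [e3 E3] := edge_exists yz; exists e1, e2, e3; split=> //.
  by rewrite !inE E1 E2 E3; split; apply/subsetP => t; rewrite !inE; do 3!case: (t == _).
have neq (e e' : edge T) t : t \in val e -> t \notin val e' -> e != e'.
  by move=> te te'; apply: contraNneq te' => <-.
split.
- by apply: (neq _ _ y); rewrite ?E1 ?E2 !inE ?eqxx ?orbT // negb_or eq_sym xy yz.
- by apply: (neq _ _ x); rewrite ?E1 ?E3 !inE ?eqxx // negb_or xy xz.
- by apply: (neq _ _ x); rewrite ?E2 ?E3 !inE ?eqxx // negb_or xy xz.
Qed.

Lemma agrees_gallai : gallai c <-> no_rainbow f setT.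
Proof.
split=> [/forall_inP G x y z _ _ _|G].
  have [->|xy] := eqVneq x y; first by constructor 3.
  have [->|xz] := eqVneq x z; first by constructor 2; rewrite fC.
  have [->|yz] := eqVneq y z; first by constructor 1.
  have [//|fy] := eqVneq (f x y) (f x z); first by constructor 1.
  have [//|fz] := eqVneq (f x y) (f y z); first by constructor 2.
  have [//|fw] := eqVneq (f x z) (f y z); first by constructor 3.
  have : [set x; y; z] \in triangles T.
    by rewrite inE -setUA cardsU1 cards2 !inE negb_or xy xz yz.
  move/G/negP; case; apply/forall_inP => e eA; apply/forall_inP => e' e'A.
  apply/implyP => /eqP cE; apply/eqP/val_inj.
  case/edges_in3: eA => E; case/edges_in3: e'A => E'; rewrite E E' //=;
    move: fy fz fw; rewrite (cf E) (cf E') cE eqxx //.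
apply/forall_inP => A; rewrite inE => /eqP/card3E[x [y [z [xy xz yz ->]]]].
have [e1 [e2 [e3 [[E1 E2 E3] [A1 A2 A3] [e12 e13 e23]]]]] := triangle_edges xy xz yz.
have diff (e e' : edge T) : e \in edges_in [set x; y; z] ->
    e' \in edges_in [set x; y; z] -> e != e' -> c e = c e' ->
    ~~ rainbow c (edges_in [set x; y; z]).
  move=> eA e'A ee' cE; apply/negP => /forall_inP/(_ e eA)/forall_inP/(_ e' e'A).
  by rewrite cE eqxx (negPf ee').
case: (G x y z) => //; rewrite ?(cf E1) ?(cf E2) ?(cf E3) => /val_inj.
- exact: diff.
- exact: diff.
- exact: diff.
Qed.

Lemma agrees_mono : mono_triangles c = monotri f setT.
Proof.
apply/setP => A; apply/idP/idP.
  rewrite inE [A \in triangles T]inE => /andP[/eqP/card3E[x [y [z [xy xz yz ->]]]]].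
  have [e1 [e2 [e3 [[E1 E2 E3] [A1 A2 A3] _]]]] := triangle_edges xy xz yz.
  move/forall_inP/(_ e1 A1)/forall_inP => H.
  apply: mem_monotri; rewrite ?inE // (cf E1) ?(cf E2) ?(cf E3).
    by rewrite (eqP (H e2 A2)).
  by rewrite (eqP (H e3 A3)).
case/monotriP => x [y [z [_ [xy xz yz] fy fz ->]]].
rewrite inE [_ \in triangles T]inE -{1}setUA cardsU1 cards2 !inE negb_or xy xz yz /=.
have col e : e \in edges_in [set x; y; z] -> c e = f x y :> nat.
  by case/edges_in3 => E; rewrite -(cf E).
by apply/forall_inP => e /col ce; apply/forall_inP => e' /col ce'; rewrite -val_eqE /= ce ce'.
Qed.

End Agrees.

(** Preimages of the vertices of a triangle in [V] span a triangle for [g], which [h] maps back to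
    it. *)
Lemma monotri_transfer (T T' : finType) (h : T' -> T) f g (V : {set T}) :
    (forall i j, f (h i) (h j) = g i j) -> {in V, forall x, exists i, x = h i} ->
  #|monotri f V| <= #|monotri g [set: T']|.
Proof.
move=> fg hV.
apply: leq_trans (leq_imset_card (fun A : {set T'} => h @: A) (monotri g setT)).
apply/subset_leq_card/subsetP => A /monotriP[x [y [z [[xV yV zV] [xy xz yz] fy fz ->]]]].
have [i xE] := hV x xV; have [j yE] := hV y yV; have [l zE] := hV z zV.
move: xy xz yz fy fz; rewrite {}xE {}yE {}zE !fg => xy xz yz fy fz.
apply/imsetP; exists [set i; j; l]; last by rewrite !imsetU !imset_set1.
have neq t u : h t != h u -> t != u by apply: contraNneq => ->.
by apply: mem_monotri; rewrite ?inE // neq.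
Qed.

Lemma card_bigcup_le (I T : finType) (F : I -> {set T}) :
  #|\bigcup_i F i| <= \sum_i #|F i|.
Proof.
elim/big_ind2: _ => [|m A n B Am Bn|//]; first by rewrite cards0.
exact: leq_trans (leq_card_setU A B) (leq_add Am Bn).
Qed.

(** * The blow-up of the pentagon *)

(* The pentagon and its complement: the triangle-free 2-colouring of K_5. *)
Definition pentagon (i j : nat) : bool :=
  ((i + 4 * j) %% 5 == 1) || ((j + 4 * i) %% 5 == 1).

Lemma pentagonC : commutative pentagon.
Proof. by move=> i j; rewrite /pentagon orbC. Qed.

Lemma pentagon_triangle i j l : i < 5 -> j < 5 -> l < 5 ->
    i != j -> i != l -> j != l ->
  pentagon i j = pentagon i l -> pentagon i j <> pentagon j l.
Proof. by do 5?case: i => [|i] //; do 5?case: j => [|j] //; do 5?case: l => [|l]. Qed.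

(** Lower digits get larger colours: labels that differ at the current digit have colour at least
    [j'.*2], distinct labels that agree there have a smaller one. *)
Fixpoint digit_color (j a b : nat) : nat :=
  if j is j'.+1 then
    if a %% 5 == b %% 5 then digit_color j' (a %/ 5) (b %/ 5)
    else j'.*2 + pentagon (a %% 5) (b %% 5)
  else 0.

Lemma digit_colorC j : commutative (digit_color j).
Proof.
by elim: j => //= j IHj a b; rewrite eq_sym IHj pentagonC.
Qed.

Lemma digit_neq j a b : a < 5 ^ j.+1 -> b < 5 ^ j.+1 -> a != b -> a %% 5 = b %% 5 ->
  [/\ a %/ 5 < 5 ^ j, b %/ 5 < 5 ^ j & a %/ 5 != b %/ 5].
Proof.
rewrite expnSr => aj bj ab m; rewrite !ltn_divLR //; split=> //.
by apply: contraNneq ab => d; rewrite (divn_eq a 5) (divn_eq b 5) d m.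
Qed.

Lemma digit_color_lt j a b : a < 5 ^ j -> b < 5 ^ j -> a != b ->
  digit_color j a b < j.*2.
Proof.
elim: j a b => [|j IHj] a b aj bj ab.
  by move: aj bj ab; rewrite expn0 !ltnS !leqn0 => /eqP-> /eqP->.
rewrite /= doubleS; case: eqP => [m|_]; last by case: pentagon; rewrite ?addn1 ?addn0.
have [? ? ?] := digit_neq aj bj ab m.
by do 2!apply: leqW; exact: IHj.
Qed.

(** At the first digit that separates the three labels, either two agree and see the third alike, or
    three distinct digits share two colours. *)
Lemma digit_color_gallai j a b c :
  [\/ digit_color j a b = digit_color j a c, digit_color j a b = digit_color j b c
    | digit_color j a c = digit_color j b c].
Proof.
elim: j a b c => [|j IHj] a b c /=; first by constructor 1.
have [ab|ab] := eqVneq (a %% 5) (b %% 5).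
  have [ac|ac] := eqVneq (a %% 5) (c %% 5); last by constructor 3; rewrite -ab (negPf ac).
  by rewrite -ab ac eqxx.
have [ac|ac] := eqVneq (a %% 5) (c %% 5).
  by constructor 2; rewrite -ac eq_sym (negPf ab) pentagonC.
have [bc|bc] := eqVneq (b %% 5) (c %% 5); first by constructor 1; rewrite bc.
case: (pentagon (a %% 5) (b %% 5)); case: (pentagon (a %% 5) (c %% 5)); case: (pentagon _ _);
 by [constructor 1 | constructor 2 | constructor 3].
Qed.

(** Pairs that agree at the lowest digit have smaller colours than the others, so the three lowest
    digits are all equal, where induction applies, or all distinct, where [pentagon_triangle]
    does. *)
Lemma digit_color_triangle j a b c : a < 5 ^ j -> b < 5 ^ j -> c < 5 ^ j ->
    a != b -> a != c -> b != c ->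
  digit_color j a b = digit_color j a c -> digit_color j a b <> digit_color j b c.
Proof.
elim: j a b c => [|j IHj] a b c aj bj cj ab ac bc.
  by move: aj bj ab; rewrite expn0 !ltnS !leqn0 => /eqP-> /eqP->.
have low u v : u < 5 ^ j.+1 -> v < 5 ^ j.+1 -> u != v -> u %% 5 = v %% 5 ->
    digit_color j (u %/ 5) (v %/ 5) < j.*2.
  by move=> uj vj uv m; have [? ? ?] := digit_neq uj vj uv m; exact: digit_color_lt.
rewrite /=; have [mab|mab] := eqVneq (a %% 5) (b %% 5).
  have [mac|mac] := eqVneq (a %% 5) (c %% 5).
    rewrite -mab mac eqxx; have [? ? ?] := digit_neq aj bj ab mab.
    by have [? ? ?] := digit_neq aj cj ac mac; apply: IHj => //;
      have [] := digit_neq bj cj bc (etrans (esym mab) mac).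
  by have := low a b aj bj ab mab; lia.
have [mac|mac] := eqVneq (a %% 5) (c %% 5); first by have := low a c aj cj ac mac; lia.
have [mbc|mbc] := eqVneq (b %% 5) (c %% 5); first by have := low b c bj cj bc mbc; lia.
move=> /addnI E1 /addnI E2.
apply: (@pentagon_triangle (a %% 5) (b %% 5) (c %% 5)); rewrite ?ltn_mod //.
  by move: E1; do 2!case: pentagon.
by move: E2; do 2!case: pentagon.
Qed.
(** The value 0 beyond [l] lets the blow-up evaluate the base colouring at quotients without a proof
    of their bound. *)
Lemma base_coloring s l h : (exists c : coloring s 'I_l, #|mono_triangles c| <= h) ->
  exists g : nat -> nat -> nat,
  [/\ commutative g, forall i j : 'I_l, i != j -> g i j < s
    & #|monotri (fun i j : 'I_l => g i j) setT| <= h].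
Proof.
case=> c ch; have [f fC cf] := fun_of_coloring c.
exists (fun i j => if insub i is Some x then
                    if insub j is Some y then f x y else 0 else 0).
split=> [i j|i j ij|].
- by case: insub => [x|]; case: insub.
- have [e eE] := edge_exists ij.
  by rewrite !valK (cf _ _ e eE).
rewrite (agrees_mono cf) in ch.
apply: leq_trans ch; apply: (@monotri_transfer _ _ id) => [i j|x _].
  by rewrite !valK.
by exists x.
Qed.

Section Construction.

Variables (s j m r n : nat) (g g1 : nat -> nat -> nat) (h h1 : nat).
Hypotheses (s2 : s <= 2) (rq : r <= 5 ^ j) (nE : n = 5 ^ j * m + r).
Hypotheses (gC : commutative g) (g1C : commutative g1).
Hypothesis gs : forall x y : 'I_m, x != y -> g x y < s.
Hypothesis g1s : forall x y : 'I_m.+1, x != y -> g1 x y < s.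
Hypothesis gh : #|monotri (fun x y : 'I_m => g x y) setT| <= h.
Hypothesis g1h : #|monotri (fun x y : 'I_m.+1 => g1 x y) setT| <= h1.

(** As [n = 5 ^ j * m + r], each residue below [r] has [m.+1] vertices and each other one [m],
    numbered by their quotients. *)
Let label (x : 'I_n) := x %% 5 ^ j.
Let pos (x : 'I_n) := x %/ 5 ^ j.

Definition blowup (x y : 'I_n) : nat :=
  if label x == label y then
    if label x < r then g1 (pos x) (pos y) else g (pos x) (pos y)
  else s + digit_color j (label x) (label y).

Let label_lt x : label x < 5 ^ j.
Proof. by rewrite ltn_mod expn_gt0. Qed.

Lemma blowupC : commutative blowup.
Proof.
move=> x y; rewrite /blowup eq_sym; have [->|_] := eqVneq (label y) (label x).
  by rewrite gC g1C.
by rewrite digit_colorC.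
Qed.

Let pos_le (x : 'I_n) : pos x < if label x < r then m.+1 else m.
Proof.
have : x < 5 ^ j * m + r by rewrite -nE.
rewrite {1}(divn_eq x (5 ^ j)) -/(label x) -/(pos x) => xn.
have := label_lt x; case: (ltnP (label x) r) => xr lx.
  rewrite ltnNge; apply/negP => mp.
  have : 5 ^ j * m.+1 <= 5 ^ j * pos x by rewrite leq_mul2l mp orbT.
  by rewrite mulnS; lia.
rewrite ltnNge; apply/negP => mp.
have : 5 ^ j * m <= 5 ^ j * pos x by rewrite leq_mul2l mp orbT.
by lia.
Qed.

Lemma blowup_in x y : x != y -> label x = label y -> blowup x y < s.
Proof.
move=> xy lxy; rewrite /blowup lxy eqxx.
have pxy : pos x != pos y.
  apply: contra_neq xy => pxy; apply/val_inj => /=.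
  by rewrite (divn_eq x (5 ^ j)) (divn_eq y (5 ^ j)) -/(pos x) pxy -/(label x) lxy.
have := pos_le x; have := pos_le y; rewrite lxy; case: ifP => _ py px.
  exact: (g1s (x := Ordinal px) (y := Ordinal py)).
exact: (gs (x := Ordinal px) (y := Ordinal py)).
Qed.

Lemma blowup_lt x y : x != y -> blowup x y < s + j.*2.
Proof.
move=> xy; have [lxy|lxy] := eqVneq (label x) (label y).
  by apply: leq_trans (blowup_in xy lxy) (leq_addr _ _).
by rewrite /blowup (negPf lxy) ltn_add2l digit_color_lt.
Qed.

(** Three vertices of one label use at most [s <= 2] colours; two of one label see the third alike;
    three labels fall under [digit_color_gallai]. *)
Lemma blowup_gallai : no_rainbow blowup setT.
Proof.
move=> x y z _ _ _.
have [->|xy] := eqVneq x y; first by constructor 3.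
have [->|xz] := eqVneq x z; first by constructor 2; rewrite blowupC.
have [->|yz] := eqVneq y z; first by constructor 1.
have [lxy|lxy] := eqVneq (label x) (label y).
  have [lxz|lxz] := eqVneq (label x) (label z).
    have lyz : label y = label z by rewrite -lxy.
    have := blowup_in xy lxy; have := blowup_in xz lxz; have := blowup_in yz lyz.
    move=> c1 c2 c3.
    have [|n1] := eqVneq (blowup x y) (blowup x z); first by constructor 1.
    have [|n2] := eqVneq (blowup x y) (blowup y z); first by constructor 2.
    by constructor 3; move: n1 n2 => /eqP n1 /eqP n2; lia.
  by constructor 3; rewrite /blowup -lxy (negPf lxz).
have [lxz|lxz] := eqVneq (label x) (label z).
  by constructor 2; rewrite /blowup -lxz (negPf lxy) eq_sym (negPf lxy) digit_colorC.
have [lyz|lyz] := eqVneq (label y) (label z).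
  by constructor 1; rewrite /blowup -lyz (negPf lxy).
rewrite /blowup (negPf lxy) (negPf lxz) (negPf lyz).
by case: (digit_color_gallai j (label x) (label y) (label z)) => ->;
  [constructor 1 | constructor 2 | constructor 3].
Qed.

(** Colours are below [s] inside a label and at least [s] between labels, so a monochromatic
    triangle has all labels equal or all distinct; [digit_color_triangle] excludes the latter. *)
Lemma blowup_mono : monotri blowup setT \subset
  \bigcup_(b < 5 ^ j) monotri blowup [set x | label x == b].
Proof.
apply/subsetP => _ /monotriP[x [y [z [_ [xy xz yz] fy fz ->]]]].
have blowup_out u v : label u != label v ->
    blowup u v = s + digit_color j (label u) (label v).
  by rewrite /blowup => /negPf->.
suff [lxy lxz] : label x = label y /\ label x = label z.
  apply/bigcupP; exists (Ordinal (label_lt x)) => //.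
  by apply: mem_monotri; rewrite // inE /= ?lxy // -?lxy ?lxz.
have [lxy|lxy] := eqVneq (label x) (label y).
  split=> //; apply/eqP/negPn/negP => lxz.
  by have := blowup_in xy lxy; rewrite fy blowup_out //; lia.
have [lxz|lxz] := eqVneq (label x) (label z).
  by have := blowup_in xz lxz; rewrite -fy blowup_out //; lia.
have [lyz|lyz] := eqVneq (label y) (label z).
  by have := blowup_in yz lyz; rewrite -fz blowup_out //; lia.
move: fy fz; rewrite !blowup_out // => /addnI fy /addnI fz.
by case: (digit_color_triangle (label_lt x) (label_lt y) (label_lt z) lxy lxz lyz fy fz).
Qed.

Lemma blowup_block (b : 'I_(5 ^ j)) :
  #|monotri blowup [set x | label x == b]| <= if b < r then h1 else h.
Proof.
(* The size [l] is a variable so that one inverse of [pos] serves both block sizes. *)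
have lift l (i : 'I_l) : l = (if b < r then m.+1 else m) -> i * 5 ^ j + b < n.
  move=> lE; have := ltn_ord i; rewrite {}nE {2}lE; have := ltn_ord b.
  case: (ltnP b r) => br bq il.
    have : 5 ^ j * i <= 5 ^ j * m by rewrite leq_mul2l -ltnS il orbT.
    by lia.
  have : 5 ^ j * i.+1 <= 5 ^ j * m by rewrite leq_mul2l il orbT.
  by rewrite mulnS; lia.
have q0 : 0 < 5 ^ j by rewrite expn_gt0.
have lab i (H : i * 5 ^ j + b < n) : label (Ordinal H) = b.
  by rewrite /label /= modnMDl modn_small.
have poslift i (H : i * 5 ^ j + b < n) : pos (Ordinal H) = i.
  by rewrite /pos /= divnMDl // divn_small // addn0.
have onto l (lE : l = if b < r then m.+1 else m) (x : 'I_n) :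
    label x == b -> exists i, x = Ordinal (lift l i lE).
  move=> /eqP lx; have := pos_le x; rewrite lx -lE => xl.
  exists (Ordinal xl); apply/val_inj; rewrite /= -lx; exact: divn_eq.
case: ifP => br.
  have lE : m.+1 = if b < r then m.+1 else m by rewrite br.
  apply: leq_trans g1h.
  apply: (@monotri_transfer _ _ (fun i => Ordinal (lift _ i lE))) => [i i'|x].
    by rewrite /blowup !lab eqxx br !poslift.
  by rewrite inE; exact: onto.
have lE : m = if b < r then m.+1 else m by rewrite br.
apply: leq_trans gh.
apply: (@monotri_transfer _ _ (fun i => Ordinal (lift _ i lE))) => [i i'|x].
  by rewrite /blowup !lab eqxx br !poslift.
by rewrite inE; exact: onto.
Qed.

Lemma blowup_count : #|monotri blowup setT| <= r * h1 + (5 ^ j - r) * h.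
Proof.
apply: leq_trans (subset_leq_card blowup_mono) _.
apply: leq_trans (card_bigcup_le _) _.
apply: (@leq_trans (\sum_(b < 5 ^ j) if b < r then h1 else h)).
  by apply: leq_sum => b _; exact: blowup_block.
rewrite -(big_mkord xpredT (fun b => if b < r then h1 else h)).
rewrite (big_cat_nat (n := r)) //=.
rewrite (eq_big_nat _ _ (F2 := fun _ => h1)); last by move=> i /andP[_ ->].
rewrite [X in _ + X](eq_big_nat _ _ (F2 := fun _ => h)); last first.
  by move=> i /andP[]; rewrite leqNgt => /negPf->.
by rewrite !sum_nat_const_nat subn0.
Qed.

End Construction.

(** Odd numbers of colours take [s = 1] and a binomial [h]; even ones take [s = 2] and [h = M2]. *)
Lemma g3_upper s j m r n (h : nat -> nat) :
    0 < s <= 2 -> (forall l, exists c : coloring s 'I_l, #|mono_triangles c| <= h l) ->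
    r <= 5 ^ j -> n = 5 ^ j * m + r ->
  g3 (s + j.*2) n <= r * h m.+1 + (5 ^ j - r) * h m.
Proof.
move=> /andP[s0 s2] base rq nE.
have [g [gC gs gh]] := base_coloring (base m).
have [g1 [g1C g1s g1h]] := base_coloring (base m.+1).
pose F := blowup s j r (n := n) g g1.
have FC : commutative F by exact: blowupC.
have [c cF] : exists c : coloring (s + j.*2) 'I_n, agrees c F.
  by apply: coloring_of_fun => // x y; exact: (blowup_lt s2 rq nE gs g1s gh g1h).
have k0 : 0 < s + j.*2 by rewrite addn_gt0 s0.
apply: leq_trans ((g3P n k0).2 c _) _.
  by apply/(agrees_gallai FC cF); exact: (blowup_gallai s2 rq nE gC g1C gs g1s gh g1h).
by rewrite (agrees_mono cF); exact: (blowup_count s2 rq nE gs g1s gh g1h).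
Qed.

(** * The two parities, and orders without monochromatic triangles *)

Lemma M2_le5 m : m <= 5 -> M2 m = 0.
Proof.
move=> m5; pose f (x y : 'I_m) : nat := pentagon x y.
have fC : commutative f by move=> x y; rewrite /f pentagonC.
have [c cf] : exists c : coloring 2 'I_m, agrees c f.
  by apply: coloring_of_fun => // x y _; rewrite /f; case: pentagon.
apply/eqP; rewrite -leqn0; apply: leq_trans ((M2P m).2 c) _.
rewrite (agrees_mono cf) leqn0 cards_eq0 -subset0.
apply/subsetP => A /monotriP[x [y [z [_ [xy xz yz] fy fz _]]]]; exfalso.
have lt5 (t : 'I_m) : t < 5 by apply: leq_trans m5.
apply: (pentagon_triangle (lt5 x) (lt5 y) (lt5 z)) => //.
  by move: fy; rewrite /f; do 2!case: pentagon.
by move: fz; rewrite /f; do 2!case: pentagon.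
Qed.

Lemma constant_base l : exists c : coloring 1 'I_l, #|mono_triangles c| <= 'C(l, 3).
Proof. by exists [ffun=> ord0]; exact: mono_triangles_le. Qed.

Lemma M2_base l : exists c : coloring 2 'I_l, #|mono_triangles c| <= M2 l.
Proof. by have [[c cM] _] := M2P l; exists c; rewrite cM. Qed.

Lemma g3_odd_upper j m r : r <= 5 ^ j ->
  g3 (1 + j.*2) (5 ^ j * m + r) <= r * 'C(m.+1, 3) + (5 ^ j - r) * 'C(m, 3).
Proof. by move=> rq; apply: (g3_upper (h := fun l => 'C(l, 3))) => //; exact: constant_base. Qed.

Lemma g3_even_upper j m r : r <= 5 ^ j ->
  g3 (2 + j.*2) (5 ^ j * m + r) <= r * M2 m.+1 + (5 ^ j - r) * M2 m.
Proof. by move=> rq; apply: g3_upper => //; exact: M2_base. Qed.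

Lemma oddE k : odd k -> k = 1 + ((k - 1) %/ 2).*2 /\ k./2 = (k - 1) %/ 2.
Proof. lia. Qed.

Lemma evenE k : 0 < k -> ~~ odd k ->
  k = 2 + ((k - 1) %/ 2).*2 /\ k./2 = ((k - 1) %/ 2).+1.
Proof. lia. Qed.

Lemma g3_gallai_max k n : 0 < k -> n <= gallai_max k -> g3 k n = 0.
Proof.
move=> k0 nk; pose j := (k - 1) %/ 2; pose m := n %/ 5 ^ j; pose r := n %% 5 ^ j.
have q0 : 0 < 5 ^ j by rewrite expn_gt0.
have rq : r <= 5 ^ j by rewrite ltnW // ltn_mod.
have nE : n = 5 ^ j * m + r by rewrite mulnC -divn_eq.
(* [L] will be the largest base size without triangles, 2 for one colour and 5 for two. If [0 < r]
   then [m < L], so blocks of size [m.+1] are triangle-free too. *)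
have zero (h : nat -> nat) L : (forall l, l <= L -> h l = 0) -> n <= L * 5 ^ j ->
    r * h m.+1 + (5 ^ j - r) * h m = 0.
  move=> h0 nL; have mL : m <= L by rewrite -(mulnK L q0) leq_div2r.
  rewrite (h0 m mL) muln0 addn0; have [-> //|r0] := posnP r.
  have {}mL : m < L.
    rewrite -(ltn_pmul2l q0) [5 ^ j * L]mulnC; apply: leq_trans nL.
    by rewrite nE -[ltnLHS]addn0 ltn_add2l.
  by rewrite h0 ?muln0.
apply/eqP; rewrite -leqn0; move: nk; rewrite /gallai_max.
have [/oddE[kE ->] nk|/(evenE k0)[kE ->] nk] := ifPn.
  rewrite kE -/j nE; apply: leq_trans (g3_odd_upper m rq) _.
  by rewrite (zero (fun l => 'C(l, 3)) 2) // => l l2; rewrite bin_small.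
rewrite kE -/j nE; apply: leq_trans (g3_even_upper m rq) _.
by rewrite (zero M2 5) -?expnS //; exact: M2_le5.
Qed.

(** * Averaging *)

Lemma card_supersets (T : finType) (A : {set T}) N : #|A| <= N ->
  #|[set S : {set T} | (A \subset S) && (#|S| == N)]| = 'C(#|T| - #|A|, N - #|A|).
Proof.
move=> AN; have <- : #|~: A| = #|T| - #|A| by rewrite -(cardsC A) addKn.
rewrite -cards_draws; set D := [set B : {set T} | B \subset ~: A & _].
have inj : {in D &, injective (fun B => A :|: B)}.
  move=> B B'; rewrite !inE => /andP[BA _] /andP[B'A _] /= /setP E.
  apply/setP => t; have := E t; rewrite !inE.
  have := subsetP BA t; have := subsetP B'A t; rewrite !inE.
  by case: (t \in A) => //= b1 b2 _; apply/idP/idP => [/b2|/b1].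
rewrite -(card_in_imset inj); apply: eq_card => S; rewrite inE; apply/andP/imsetP.
  case=> AS /eqP SN; exists (S :\: A); last first.
    by apply/setP => t; rewrite !inE; have := subsetP AS t; case: (t \in A) => // ->.
  by rewrite inE subDset setUCr subsetT cardsD (setIidPr AS) SN eqxx.
case=> B; rewrite inE => /andP[BA /eqP BN] ->; rewrite subsetUl; split=> //.
rewrite cardsU (_ : A :&: B = set0) ?cards0 ?BN ?subn0 ?subnKC //.
by apply/eqP; rewrite setI_eq0 disjoint_sym disjoints_subset.
Qed.

(** Both sides count the pairs of an [i]-set inside an [N]-set; the proof compares factorials. *)
Lemma bin_subset_of_subset n N i : i <= N -> N <= n ->
  'C(n, N) * 'C(N, i) = 'C(n, i) * 'C(n - i, N - i).
Proof.
move=> iN Nn; have in_ := leq_trans iN Nn.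
have e1 := bin_fact Nn; have e2 := bin_fact iN; have e3 := bin_fact in_.
have e4 := bin_fact (leq_sub2r i Nn).
rewrite subnBA // subnK // in e4.
have p0 : 0 < i`! * ((N - i)`! * (n - N)`!) by rewrite !muln_gt0 !fact_gt0.
apply/eqP; rewrite -(eqn_pmul2r p0); apply/eqP.
transitivity n`!.
  by rewrite -[RHS]e1 -{1}e2; lia.
by rewrite -[LHS]e3 -{1}e4; lia.
Qed.

(** Count in two ways the pairs of a member of [M] and an [N]-set containing it, then cancel the
    number of [N]-sets above a given [i]-set. *)
Lemma averaging (T : finType) (M : {set {set T}}) i N s :
    {in M, forall A : {set T}, #|A| = i} -> i <= N -> N <= #|T| ->
    (forall S : {set T}, #|S| = N -> s <= #|[set A in M | A \subset S]|) ->
  s * 'C(#|T|, i) <= #|M| * 'C(N, i).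
Proof.
move=> Mi iN Nn Ms.
have dc : s * 'C(#|T|, N) <= #|M| * 'C(#|T| - i, N - i).
  rewrite -card_draws mulnC -sum_nat_const.
  apply: (@leq_trans (\sum_(S in [set S : {set T} | #|S| == N]) \sum_(A in M | A \subset S) 1)).
    apply: leq_sum => S; rewrite inE => /eqP/Ms; move/leq_trans; apply.
    by rewrite -sum1_card; apply/eq_leq/eq_bigl => A; rewrite inE.
  rewrite (exchange_big_dep (mem M)) /=; last by move=> S A _ /andP[].
  rewrite -sum_nat_const; apply: leq_sum => A AM.
  rewrite -(Mi A AM) -card_supersets ?(Mi A AM) // -sum1_card.
  by apply/eq_leq/eq_bigl => S; rewrite !inE AM andbC.
have p0 : 0 < 'C(#|T| - i, N - i) by rewrite bin_gt0 leq_sub2r.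
rewrite -(leq_pmul2r p0) -mulnA -bin_subset_of_subset //.
by rewrite mulnA [leqRHS]mulnAC leq_mul2r dc orbT.
Qed.

(** * The lower bound and the theorem *)

Lemma GR3P k : forces_mono k (GR3 k).
Proof. by rewrite /GR3; case: ex_minnP. Qed.

(** An optimal colouring of at most [gallai_max k] vertices has no monochromatic triangle, whereas
    [GR3 k] vertices force one. *)
Lemma gallai_max_lt_GR3 k : 0 < k -> gallai_max k < GR3 k.
Proof.
move=> k0; rewrite ltnNge; apply/negP => /(g3_gallai_max k0) g0.
have [[c cG cM] _] := g3P (GR3 k) k0.
have /forall_inP/(_ c cG) := GR3P k.
by rewrite -cards_eq0 cM g0.
Qed.

Lemma g3_lower k n : 0 < k -> GR3 k <= n ->
  (if odd k then 1 else 2) * 'C(n, 3) <= g3 k n * 'C(GR3 k, 3).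
Proof.
move=> k0 Nn; have [[c cG <-] _] := g3P n k0.
have [f fC cf] := fun_of_coloring c.
have fG : no_rainbow f setT by apply/(agrees_gallai fC cf).
rewrite (agrees_mono cf) -{1}(card_ord n).
have Nk := gallai_max_lt_GR3 k0.
apply: averaging; rewrite ?card_ord //.
- move=> A /monotriP[x [y [z [_ [xy xz yz] _ _ ->]]]].
  by rewrite -setUA cardsU1 cards2 !inE negb_or xy xz yz.
- by apply: leq_trans Nk; rewrite ltnS gallai_max_gt1.
move=> S SN; rewrite (_ : (if _ then _ else _) = (~~ odd k).+1); last by case: odd.
have big : gallai_max k < #|S| by rewrite SN.
apply: leq_trans (gallai_monotri (C := iota 0 k) fC _ big _ _) _.
- by rewrite size_iota.
- exact: no_rainbowS (subsetT _) fG.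
- move=> x y _ _ xy; have [e eE] := edge_exists xy.
  by rewrite (cf _ _ e eE) mem_iota /=.
apply/subset_leq_card/subsetP => A AS.
by rewrite inE (subsetP (monotriS f (subsetT S))) // (monotri_sub AS).
Qed.

Import GRing.Theory Num.Theory.

Theorem theorem1p4 (k n m r : nat) (hk : (1 <= k)%N) (hn : (GR3 k <= n)%N)
    (hnmr : n = (5 ^ ((k - 1) %/ 2) * m + r)%N)
    (hr : (r <= 5 ^ ((k - 1) %/ 2) - 1)%N) :
  (g3 k n <=
     if odd k then r * 'C(m.+1, 3) + (5 ^ ((k - 1) %/ 2) - r) * 'C(m, 3)
     else r * M2 m.+1 + (5 ^ ((k - 2) %/ 2) - r) * M2 m)%N /\
  ((if odd k then 1 else 2) * n%:R * (n%:R - 1) * (n%:R - 2)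
     / ((GR3 k)%:R * ((GR3 k)%:R - 1) * ((GR3 k)%:R - 2))
   <= (g3 k n)%:R :> rat)%R.
Proof.
have rq : r <= 5 ^ ((k - 1) %/ 2) by apply: leq_trans hr (leq_subr _ _).
have N3 : 3 <= GR3 k.
  by apply: leq_trans (gallai_max_lt_GR3 hk); rewrite ltnS gallai_max_gt1.
split.
  rewrite {1}hnmr; case: ifPn => [/oddE[kE _]|ok].
    by rewrite {1}kE; exact: g3_odd_upper.
  have [kE _] := evenE hk ok.
  have -> : (k - 2) %/ 2 = (k - 1) %/ 2 by lia.
  by rewrite {1}kE; exact: g3_even_upper.
(* For [3 <= l] truncated subtraction agrees with that of [rat]; [N3] lets this apply to the
   denominator and makes it positive. *)
have ffactE l : 3 <= l -> (('C(l, 3) * 6)%N%:R = l%:R * (l%:R - 1) * (l%:R - 2) :> rat)%R.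
  move=> l3; rewrite (_ : 6 = 3`!) // bin_ffact !ffactnS ffactn0 muln1 !natrM mulrA.
  by rewrite -!subn1 -subnDA !natrB //; apply: leq_trans l3.
have low : ((if odd k then 1 else 2) * 'C(n, 3) * 6 <= g3 k n * ('C(GR3 k, 3) * 6)).
  by rewrite mulnA leq_mul2r g3_lower.
rewrite -ffactE // ler_pdivrMr ?ltr0n ?muln_gt0 ?bin_gt0 ?N3 //.
have -> : ((if odd k then 1 else 2) * n%:R * (n%:R - 1) * (n%:R - 2) =
    ((if odd k then 1 else 2) * 'C(n, 3) * 6)%N%:R :> rat)%R.
  rewrite -mulnA natrM ffactE ?(leq_trans N3) // !mulrA; by case: odd.
by rewrite -natrM ler_nat.
Qed.
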